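(* Let $q=p^n$ with $p$ prime and $n\ge 2$, and let $m$ be an integer with $1\le m\le p-1$. Let $V[x]$ be the $\mathbb{F}_q$-vector space of polynomials $f\in\mathbb{F}_q[x]$ of degree at most $q-2$ with $f(0)=0$, and let $A:V[x]\to V[x]$ be the linear map $A(f)(x)=f(x+1)-f(1)$. Then $\ker(A-I)^m$ is spanned by the polynomials $x^j(x^p-x)^i$ for $j=0,1,\ldots,m-1$ and $i=1,2,\ldots,p^{n-1}-1$, together with the monomials $x^k$ for $k=1,2,\ldots,m$.
   Context: Polynomials in $V[x]$ are formal polynomials; $f(x+1)$ denotes formal substitution; $I$ is the identity map of $V[x]$. *)

(* Defs.v *)
From HB Require Import structures.
From mathcomp Require Import all_boot all_order all_algebra.

Set Implicit Arguments.
Unset Strict Implicit.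
Unset Printing Implicit Defensive.

Import GRing.Theory.
Local Open Scope ring_scope.

Section Vspace.
Variable F : finFieldType.

Definition eval0 (f : {poly_(#|F|.-1) F}) : F^o := (polyn f).[0].

Fact eval0_is_linear : linear eval0.
Proof. by move=> a f g; rewrite /eval0 /= hornerD hornerZ. Qed.

HB.instance Definition _ :=
  GRing.isLinear.Build F {poly_(#|F|.-1) F} F^o _ eval0 eval0_is_linear.

(* Degree at most #|F| - 2 is size at most #|F| - 1. *)
Definition Vspace : {vspace {poly_(#|F|.-1) F}} := lker (linfun eval0).

End Vspace.

Notation Vx F := (subvs_of (Vspace F)).

Section Shift.
Variable F : finFieldType.

Definition vpoly (f : Vx F) : {poly F} := polyn (vsval f).

Lemma mem_Vspace (f : {poly_(#|F|.-1) F}) :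
  (f \in Vspace F) = ((polyn f).[0] == 0).
Proof. by rewrite memv_ker lfunE. Qed.

Lemma vpoly_inj : injective vpoly.
Proof. by move=> f g /val_inj /val_inj. Qed.

Lemma size_vpoly (f : Vx F) : (size (vpoly f) <= #|F|.-1)%N.
Proof. exact: size_npoly. Qed.

Lemma vpoly0 (f : Vx F) : (vpoly f).[0] = 0.
Proof. by apply/eqP; rewrite -mem_Vspace; apply: subvsP. Qed.

Lemma VxP (f : {poly F}) :
  (size f <= #|F|.-1)%N && (f.[0] == 0) <-> exists g : Vx F, vpoly g = f.
Proof.
split=> [/andP[sf f0]|[g <-]]; last by rewrite size_vpoly vpoly0 /=.
have Vf : @NPoly F #|F|.-1 f sf \in Vspace F by rewrite mem_Vspace.
by exists (Subvs Vf).
Qed.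

Definition shift_poly (f : {poly F}) : {poly F} :=
  f \Po ('X + 1) - f.[1]%:P.

Fact shift_size (f : Vx F) :
  shift_poly (vpoly f) \is a poly_of_size #|F|.-1.
Proof.
have sf : (size (vpoly f \Po ('X + 1)) <= #|F|.-1)%N.
  by rewrite size_comp_poly2 ?size_vpoly // -[1]/(1%:P) size_XaddC.
apply: rpredB => //; apply: (leq_trans (size_polyC_leq1 _)).
have : (1 < #|F|)%N by apply/card_gt1P; exists 0, 1; rewrite // eq_sym oner_neq0.
by case: #|F| => [|[]].
Qed.

Fact shift_Vspace (f : Vx F) : NPoly (shift_size f) \in Vspace F.
Proof. by rewrite mem_Vspace /shift_poly !hornerE horner_comp !hornerE subrr. Qed.

Definition shift_Vx (f : Vx F) : Vx F := Subvs (shift_Vspace f).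

Fact shift_Vx_is_linear : linear shift_Vx.
Proof.
move=> a f g; apply: vpoly_inj; rewrite /vpoly /= /shift_poly /vpoly /=.
rewrite comp_polyD comp_polyZ hornerD hornerZ polyCD polyCM -mul_polyC.
by rewrite -mul_polyC mulrBr opprD addrACA.
Qed.

HB.instance Definition _ :=
  GRing.isLinear.Build F (Vx F) (Vx F) _ shift_Vx shift_Vx_is_linear.

Definition shiftA : 'End(Vx F) := linfun shift_Vx.

Lemma shiftAE (f : Vx F) :
  vpoly (shiftA f) = vpoly f \Po ('X + 1) - (vpoly f).[1]%:P.
Proof. by rewrite lfunE. Qed.

End Shift.

(* The library makes no ring structure on 'End(vT) canonical, hence no ^+. *)
Definition lfun_exp (K : fieldType) (vT : vectType K) (f : 'End(vT)) (m : nat)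
  : 'End(vT) := iter m (fun g => f \o g)%VF \1%VF.

Definition ker_gens (F : finFieldType) (p n m : nat) : seq {poly F} :=
  [seq 'X^j * ('X^p - 'X) ^+ i | j <- iota 0 m, i <- iota 1 (p ^ n.-1).-1]
  ++ [seq 'X^k | k <- iota 1 m].

(* Main.v *)
Require Import Defs.
From HB Require Import structures.
From mathcomp Require Import all_boot all_order all_algebra all_field.
Import GRing.Theory.
Local Open Scope ring_scope.

(** Let [D f = f(x+1) - f(x)].  On [V[x]] the power [(A - I)^m] agrees with
[D^m] up to an additive constant, so the kernel consists of the [f] for which
[D^m f] is constant.  As [t = x^p - x] is invariant under [x -> x+1], [D] is
linear over [F[t]], hence the listed generators lie in the kernel.  Conversely,
peel off the leading term of an [f] of degree [d = p i + j] in the kernel.  If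
[j < m], or if [i = 0] and [j = m], a generator has degree [d].  Otherwise
[D^m f] has degree [d - m > 0], because its coefficient there is
[d (d-1) ... (d-m+1)] times that of [f], which is nonzero modulo [p]. *)

Set Implicit Arguments.
Unset Strict Implicit.

(** * Degrees and leading coefficients of iterated forward differences *)

Section ForwardDifference.
Variable R : comNzRingType.
Implicit Types f g : {poly R}.

Definition fdiff f : {poly R} := f \Po ('X + 1) - f.

Lemma fdiff_is_linear : linear fdiff.
Proof.
by move=> a f g; rewrite /fdiff comp_polyD comp_polyZ scalerBr opprD addrACA.
Qed.

HB.instance Definition _ :=
  GRing.isLinear.Build R {poly R} {poly R} _ fdiff fdiff_is_linear.

Lemma fdiffC c : fdiff c%:P = 0.
Proof. by rewrite /fdiff comp_polyC subrr. Qed.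

Lemma fdiffMr f g : g \Po ('X + 1) = g -> fdiff (f * g) = fdiff f * g.
Proof. by move=> gE; rewrite /fdiff comp_polyM gE mulrBl. Qed.

Lemma iter_fdiffMr k f g :
  g \Po ('X + 1) = g -> iter k fdiff (f * g) = iter k fdiff f * g.
Proof. by move=> gE; elim: k => //= k ->; rewrite fdiffMr. Qed.

Lemma fdiffXn d : fdiff 'X^d = \sum_(i < d) 'X^i *+ 'C(d, i).
Proof.
rewrite /fdiff comp_Xn_poly exprD1n big_ord_recr /= binn mulr1n.
by rewrite addrK.
Qed.

Lemma size_fdiffXn d : (size (fdiff 'X^d) <= d)%N.
Proof.
rewrite fdiffXn; apply: (leq_trans (size_sum _ _ _)).
apply/bigmax_leqP => i _.
by rewrite -scaler_nat (leq_trans (size_scale_leq _ _)) // size_polyXn.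
Qed.

Lemma fdiff_sum f d : (size f <= d)%N ->
  fdiff f = \sum_(i < d) f`_i *: fdiff 'X^i.
Proof.
move=> sf; rewrite -{1}[f](coefK) poly_def linear_sum /=.
rewrite (big_ord_widen _ (fun i : nat => fdiff (f`_i *: 'X^i)) sf) big_mkcond.
apply: eq_bigr => i _; rewrite linearZ /=; case: ifP => // /negbT.
by rewrite -leqNgt => /leq_sizeP ->; rewrite ?scale0r.
Qed.

Lemma size_fdiff f d : (size f <= d.+1)%N -> (size (fdiff f) <= d)%N.
Proof.
move=> sf; rewrite (fdiff_sum sf); apply: (leq_trans (size_sum _ _ _)).
apply/bigmax_leqP => i _.
rewrite (leq_trans (size_scale_leq _ _)) // (leq_trans (size_fdiffXn _)) //.
by rewrite -ltnS.
Qed.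

(** Since [D x^i] has degree below [i], only the term in [x^(d+1)] reaches degree [d], where it
    contributes the binomial coefficient [C(d+1, d)]. *)
Lemma coef_fdiff f d : (size f <= d.+2)%N -> (fdiff f)`_d = f`_d.+1 *+ d.+1.
Proof.
move=> sf; rewrite (fdiff_sum sf) big_ord_recr /= coefD coef_sum big1.
  rewrite add0r coefZ fdiffXn big_ord_recr /= coefD coef_sum big1.
    by rewrite add0r coefMn coefXn eqxx binSn mulr_natr.
  by move=> i _; rewrite coefMn coefXn gtn_eqF ?mul0rn.
move=> i _; rewrite coefZ (leq_sizeP _ _ (size_fdiffXn _)) ?mulr0 //.
by rewrite -ltnS.
Qed.

Lemma size_iter_fdiff k f d :
  (size f <= d + k)%N -> (size (iter k fdiff f) <= d)%N.
Proof.
elim: k d => [|k IHk] d; first by rewrite addn0.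
by rewrite addnS -addSn => /IHk/size_fdiff.
Qed.

Lemma coef_iter_fdiff k f d : (size f <= (d + k).+1)%N ->
  (iter k fdiff f)`_d = f`_(d + k) *+ (d + k) ^_ k.
Proof.
elim: k d => [|k IHk] d; first by rewrite addn0 ffactn0.
rewrite addnS -addSn => sf; rewrite /= coef_fdiff; last exact: size_iter_fdiff.
by rewrite IHk // -mulrnA ffactnSr addnK.
Qed.

End ForwardDifference.

(** With [j = d %% p], the factors are congruent modulo [p] to [j, j-1, ..., j-k+1], all strictly
    between [0] and [p]. *)
Lemma natf_ffact_neq0 (R : idomainType) p k d : p \in [pchar R] ->
  (k <= d %% p)%N -> (d ^_ k)%:R != 0 :> R.
Proof.
move=> pR; elim: k => [|k IHk] kd; first by rewrite ffactn0 oner_neq0.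
rewrite ffactnSr natrM mulf_neq0 ?IHk 1?ltnW // -(dvdn_pcharf pR).
have p_gt0 : (0 < p)%N by rewrite prime_gt0 ?(pcharf_prime pR).
rewrite (divn_eq d p) -addnBA ?(ltnW kd) // dvdn_addr ?dvdn_mull //.
rewrite gtnNdvd ?subn_gt0 //.
by rewrite (leq_ltn_trans (leq_subr _ _)) ?ltn_pmod.
Qed.

(** * The translation-invariant polynomial [x^p - x] *)

Section Translation.
Variables (R : idomainType) (p : nat) (pR : p \in [pchar R]).

(** By Frobenius, [(x+1)^p = x^p + 1], and the two ones cancel. *)
Lemma comp_XpBX : ('X^p - 'X : {poly R}) \Po ('X + 1) = 'X^p - 'X.
Proof.
have pP : p \in [pchar {poly R}] by rewrite pchar_poly.
rewrite comp_polyB comp_Xn_poly comp_polyX -(pFrobenius_autE pP).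
rewrite pFrobenius_autD_comm; last exact: commr1.
by rewrite pFrobenius_aut1 pFrobenius_autE opprD addrACA subrr addr0.
Qed.

Lemma monic_XpBX : ('X^p - 'X : {poly R}) \is monic.
Proof.
have p_gt1 := prime_gt1 (pcharf_prime pR).
by rewrite monicE lead_coefDl ?lead_coefXn // size_polyN size_polyX size_polyXn.
Qed.

Lemma size_XpBX : size ('X^p - 'X : {poly R}) = p.+1.
Proof.
have p_gt1 := prime_gt1 (pcharf_prime pR).
by rewrite size_polyDl size_polyXn // size_polyN size_polyX.
Qed.

Lemma size_XnMXpBX j i :
  size ('X^j * ('X^p - 'X) ^+ i : {poly R}) = (i * p + j).+1.
Proof.
have mi : ('X^p - 'X : {poly R}) ^+ i \is monic by rewrite rpredX ?monic_XpBX.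
rewrite mulrC size_mulXn ?monic_neq0 //.
rewrite -[size _]prednK ?size_poly_gt0 ?monic_neq0 //.
by rewrite size_exp size_XpBX addnS addnC mulnC.
Qed.

End Translation.

(** * From [A - I] on [V[x]] to forward differences *)

Section ShiftSpace.
Variable F : finFieldType.
Implicit Types u v : Vx F.

Lemma vpoly_linear a u v : vpoly (a *: u + v) = a *: vpoly u + vpoly v.
Proof. by []. Qed.

(** Each application of [A - I] is [D] followed by subtracting a constant, and the next [D] kills
    that constant, so only one constant correction survives. *)
Lemma vpoly_iter_shift k u :
  let g := iter k (@fdiff F) (vpoly u) in
  vpoly (lfun_exp (shiftA F - \1%VF) k u) = g - g.[0]%:P.
Proof.
elim: k => [|k IHk] /=; first by rewrite id_lfunE vpoly0 subr0.
set g := iter k _ _ in IHk *; set h := lfun_exp _ k u in IHk.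
have hE : lfun_exp (shiftA F - \1%VF) k.+1 u = shiftA F h - h.
  by rewrite /lfun_exp /= comp_lfunE add_lfunE opp_lfunE id_lfunE.
rewrite hE; set c := (vpoly h).[1].
have E : vpoly (shiftA F h - h) = fdiff g - c%:P.
  rewrite -[_ - _]addrC -scaleN1r vpoly_linear shiftAE scaleN1r -/c.
  rewrite addrC addrAC -/(fdiff (vpoly h)) IHk linearB /=.
  by rewrite fdiffC subr0.
(* Elements of [V[x]] vanish at [0], which determines the remaining constant. *)
rewrite E; congr (_ - _%:P); apply/eqP; rewrite eq_sym -subr_eq0.
by have := vpoly0 (shiftA F h - h); rewrite E !hornerE => ->.
Qed.

Lemma mem_ker_shift k u :
  (u \in lker (lfun_exp (shiftA F - \1%VF) k)) =
  (size (iter k (@fdiff F) (vpoly u)) <= 1)%N.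
Proof.
have E := vpoly_iter_shift k u; rewrite memv_ker.
apply/eqP/idP => [k0|/size1_polyC gE].
  have /eqP : vpoly (0 : Vx F) = 0 by [].
  by rewrite -k0 E subr_eq0 => /eqP ->; rewrite size_polyC_leq1.
by apply: (@vpoly_inj F); rewrite E gE hornerC subrr.
Qed.

(** Turns the generators, given as plain polynomials, into vectors of [Vx F], where spans make
    sense. *)
Lemma lift_vpoly (s : seq {poly F}) :
  {in s, forall f : {poly F}, (size f <= #|F|.-1)%N && (f.[0] == 0)} ->
  exists S : seq (Vx F), [seq vpoly v | v <- S] = s.
Proof.
elim: s => [|f s IHs] H; first by exists [::].
have [|S <-] := IHs; first by move=> g gs; apply: H; rewrite inE gs orbT.
have /VxP[v <-] := H _ (mem_head _ _).
by exists (v :: S).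
Qed.

End ShiftSpace.

Unset Implicit Arguments.

Theorem theorem1 (p n m : nat) (F : finFieldType)
  (hp : prime p) (hn : (2 <= n)%N) (hF : #|F| = (p ^ n)%N)
  (hm1 : (1 <= m)%N) (hm2 : (m <= p - 1)%N) :
  exists S : seq (Vx F),
    [seq vpoly v | v <- S] = ker_gens F p n m /\
    lker (lfun_exp (shiftA F - \1%VF) m) = <<S>>%VS.
Proof.
have pF : p \in [pchar F] by apply: card_finPcharP hF hp.
have p_gt0 := prime_gt0 hp; have p_gt1 := prime_gt1 hp.
have mp : (m < p)%N by rewrite (leq_ltn_trans hm2) // subn1 prednK.
have qE : (p ^ n = p * p ^ n.-1)%N by rewrite -expnS prednK // ltnW.
have pn1_gt0 : (0 < p ^ n.-1)%N by rewrite expn_gt0 p_gt0.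
have p_le : (p <= p ^ n.-1)%N.
  by rewrite -[leqLHS]expn1 leq_exp2l // -ltnS prednK // ltnW.
pose t : {poly F} := 'X^p - 'X.
have t0 : t.[0] = 0 by rewrite !hornerE expr0n gtn_eqF // subrr.
have genP f : reflect
    ((exists j i, [/\ (j < m)%N, (0 < i < p ^ n.-1)%N & f = 'X^j * t ^+ i])
     \/ exists2 k, (0 < k <= m)%N & f = 'X^k)
    (f \in ker_gens F p n m).
  rewrite mem_cat; apply: (iffP orP) => -[].
  - case/allpairsP=> -[j i] /=; rewrite !mem_iota add0n add1n prednK //.
    by case=> jm ip ->; left; exists j, i.
  - case/mapP=> k; rewrite mem_iota add1n ltnS => km ->.
    by right; exists k.
  - case=> j [i [jm ip ->]]; left; apply/allpairsP; exists (j, i) => /=.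
    by rewrite !mem_iota add0n add1n prednK.
  - case=> k km ->; right; apply/mapP; exists k => //.
    by rewrite mem_iota add1n ltnS.
have genV : {in ker_gens F p n m,
    forall f : {poly F}, (size f <= #|F|.-1)%N && (f.[0] == 0)}.
  move=> f /genP[[j [i [jm /andP[i0 ip] ->]]]|[k /andP[k0 km] ->]].
    rewrite (size_XnMXpBX pF) hornerM (horner_exp t) t0
      [0 ^+ i]expr0n (gtn_eqF i0).
    rewrite mulr0 eqxx andbT hF -ltnS prednK ?expn_gt0 ?p_gt0 // qE.
    (* As [j < m < p], one has [j + 2 <= p], so the degree [i p + j] is at most [q - 2]. *)
    apply: (@leq_trans (i.+1 * p)%N); last by rewrite mulnC leq_mul2l ip orbT.
    by rewrite mulSn [leqRHS]addnC -!addnS leq_add2l (leq_ltn_trans jm mp).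
  rewrite size_polyXn !hornerE expr0n gtn_eqF // eqxx andbT hF.
  rewrite -ltnS prednK ?expn_gt0 ?p_gt0 // qE.
  (* Here [n >= 2] enters: [k + 2 <= 2 p <= p^n]. *)
  apply: (@leq_trans (p * 2)%N); last first.
    by rewrite leq_mul2l (leq_trans p_gt1 p_le) orbT.
  by rewrite muln2 -addnn -addn2 leq_add // (leq_trans km (ltnW mp)).
have [S SE] := lift_vpoly genV; exists S; split=> //.
have mem_gen v : vpoly v \in ker_gens F p n m -> v \in <<S>>%VS.
  rewrite -SE => /mapP[w wS /vpoly_inj ->]; exact: memv_span.
have gen_ker v : vpoly v \in ker_gens F p n m ->
    v \in lker (lfun_exp (shiftA F - \1%VF) m).
  rewrite mem_ker_shift => /genP[[j [i [jm _ ->]]]|[k /andP[_ km] ->]].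
    (* The invariant factor [t^i] comes out of [D^m], and [D^m x^j = 0] because [j < m]. *)
    rewrite iter_fdiffMr.
      have /size_poly_leq0P -> : (size (iter m (@fdiff F) 'X^j) <= 0)%N.
        by apply: size_iter_fdiff; rewrite size_polyXn.
      by rewrite mul0r size_poly0.
    by rewrite rmorphXn /= comp_XpBX.
  by apply: size_iter_fdiff; rewrite size_polyXn.
apply/eqP; rewrite eqEsubv; apply/andP; split; last first.
  apply/span_subvP => v vS; apply: gen_ker.
  by rewrite -SE map_f.
apply/subvP => u.
(* Strong induction on the degree, so that leading terms can be peeled off. *)
have [N] := ubnP (size (vpoly u)); elim: N u => // N IHN u sN ku.
have [u0|u_neq0] := eqVneq (vpoly u) 0.
  have -> : u = 0 by apply: vpoly_inj; rewrite u0.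
  exact: mem0v.
set d := (size (vpoly u)).-1.
have sd : size (vpoly u) = d.+1 by rewrite prednK // size_poly_gt0.
have d_gt0 : (0 < d)%N.
  rewrite lt0n; apply: contra u_neq0 => /eqP d0.
  have /size1_polyC uE : (size (vpoly u) <= 1)%N by rewrite sd d0.
  by have := vpoly0 u; rewrite uE hornerC => ->.
have [g gG [sg mg]] : exists2 g, g \in ker_gens F p n m &
    size g = d.+1 /\ g \is monic.
  have dE := divn_eq d p; set i := (d %/ p)%N in dE; set j := (d %% p)%N in dE.
  have [jm|mj] := ltnP j m.
    have [i0|i_gt0] := posnP i.
      exists 'X^d; last by rewrite size_polyXn monicXn.
      apply/genP; right; exists d => //.
      by rewrite d_gt0 dE i0 (ltnW jm).
    (* The bound on [i] follows from [i p <= d < q = p^(n-1) p]. *)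
    exists ('X^j * t ^+ i).
      apply/genP; left; exists j, i; split=> //; rewrite i_gt0 /=.
      rewrite -(ltn_pmul2r p_gt0) [ltnRHS]mulnC -qE -hF.
      have := size_vpoly u; rewrite sd => dF.
      rewrite (leq_ltn_trans _ (leq_trans dF (leq_pred _))) //.
      by rewrite [leqRHS]dE leq_addr.
    by rewrite (size_XnMXpBX pF) -dE monicMr ?monicXn ?rpredX ?monic_XpBX.
  have md : (m <= d)%N by rewrite (leq_trans mj) // leq_mod.
  have [<-|dm] := eqVneq m d.
    exists 'X^m; last by rewrite size_polyXn monicXn.
    by apply/genP; right; exists m; rewrite // hm1 leqnn.
  (* The remaining case is contradictory: [D^m u] is constant, yet its coefficient at [d - m > 0] is
     a nonzero multiple of the leading coefficient of [u]. *)
  move: ku; rewrite mem_ker_shift => /leq_sizeP /(_ (d - m)%N).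
  rewrite subn_gt0 ltn_neqAle dm md => /(_ isT) /eqP.
  rewrite coef_iter_fdiff subnK ?sd // -mulr_natr mulf_eq0.
  rewrite (negbTE (natf_ffact_neq0 pF mj)) orbF.
  by rewrite -/(lead_coef _) lead_coef_eq0 (negbTE u_neq0).
have [v vE] : exists v : Vx F, vpoly v = g by apply/VxP/genV.
have vS : v \in <<S>>%VS by rewrite mem_gen ?vE.
pose c := lead_coef (vpoly u).
have -> : u = (- c *: v + u) + c *: v by rewrite addrAC scaleNr addNr add0r.
rewrite rpredD ?rpredZ //; apply: IHN; last first.
  by rewrite rpredD ?rpredZ // gen_ker ?vE.
rewrite vpoly_linear vE -ltnS (leq_trans _ sN) // ltnS sd ltnS.
(* At degree [d] the leading terms cancel because [g] is monic; above it both polynomials vanish. *)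
apply/leq_sizeP => k; rewrite leq_eqVlt coefD coefZ => /predU1P[<-|dk].
  have gd : g`_d = 1 by rewrite -(monicP mg) /lead_coef sg.
  by rewrite gd mulr1 addNr.
by rewrite !nth_default ?sg ?sd // mulr0 addr0.
Qed.
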